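(* Let $\pi,\phi\in(0,1)$ and $\theta\in(0,1]$. In equilibrium, the fundamental price of the blockchain $f_B=v_B-v_0$ satisfies $$f_B=\frac{\pi(1-\phi)}{2}\,K_BP_B=\frac{\pi(1-\phi)}{2}\,Q .$$
   Context: Two platforms, the blockchain market ($B$) and the cash market ($C$), trade an asset of high or low quality. $\pi$ is the economy-wide fraction of high-quality assets, $\phi$ is the relative value of a low-quality asset, and $\theta$ is the probability that a low-quality asset offered in $B$ is detected and rejected. Private values $\alpha$ are uniform on $[0,1]$. $\pi_B$ is the fraction of high-quality assets among assets traded in $B$, the corresponding fraction in $C$ is $0$, $\tilde\pi_B=\pi_B+(1-\pi_B)\phi$ and $\tilde\pi_C=\phi$. An equilibrium is a tuple $(Q,P_B,P_C,\pi_B,K_B,K_C)$ with $P_B,P_C>0$, $K_B>0$, $K_C\ge 0$ such that both markets clear, $K_j=K_j^S=K_j^D$ for $j\in\{B,C\}$, where $$\alpha_I=\max\Big\{\tfrac{P_C-(1-\theta)P_B}{\phi\theta},0\Big\},$$ $$K_C^S=(1-\pi)\alpha_I,\qquad K_B^S=\pi P_B+(1-\pi)(1-\theta)\Big(\tfrac{P_B}{\phi}-\alpha_I\Big),$$ $$K_B^D=1-\frac{P_B-P_C}{\tilde\pi_B-\phi},\qquad K_C^D=\frac{P_B-P_C}{\tilde\pi_B-\phi}-\frac{P_C}{\phi},$$ $$\pi_B=\frac{\pi P_B}{K_B},\qquad Q=P_BK_B .$$ The last equation is the clearing condition for cryptocurrency (total supply normalized to 1), which buyers must hold in order to buy in $B$.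 Note that $\tilde\pi_B-\phi=(1-\phi)\pi_B$. With $\alpha^*=\frac{P_B-P_C}{\tilde\pi_B-\tilde\pi_C}$, aggregate buyers' welfare and the reservation welfare (without access to $B$) are $$v_B=\int_{\alpha^*}^1(\tilde\pi_B\alpha-P_B)\,d\alpha+\int_{P_C/\phi}^{\alpha^*}(\phi\alpha-P_C)\,d\alpha,\qquad v_0=\int_{P_C/\phi}^1(\phi\alpha-P_C)\,d\alpha .$$ The fundamental price of the blockchain is the maximal ex-ante access fee $f_B=v_B-v_0$. *)

(* Defs.v *)
From Stdlib Require Import Reals.
From Coquelicot Require Import Coquelicot.
Open Scope R_scope.

(* Expected value, relative to a high-quality asset, of an asset traded in a
   market in which a fraction [p] of the traded assets is of high quality. *)
Definition tilde_pi (phi p : R) : R := p + (1 - p) * phi.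

(* No high-quality asset is traded in C: this is [tilde_pi phi 0] simplified. *)
Definition tilde_pi_C (phi : R) : R := phi.

Definition alpha_I (phi theta PB PC : R) : R :=
  Rmax ((PC - (1 - theta) * PB) / (phi * theta)) 0.

Definition supply_C (pi phi theta PB PC : R) : R :=
  (1 - pi) * alpha_I phi theta PB PC.

Definition supply_B (pi phi theta PB PC : R) : R :=
  pi * PB + (1 - pi) * (1 - theta) * (PB / phi - alpha_I phi theta PB PC).

Definition demand_B (phi PB PC piB : R) : R :=
  1 - (PB - PC) / (tilde_pi phi piB - phi).

Definition demand_C (phi PB PC piB : R) : R :=
  (PB - PC) / (tilde_pi phi piB - phi) - PC / phi.

Record is_equilibrium (pi phi theta Q PB PC piB KB KC : R) : Prop := {
  eq_PB_pos : 0 < PB;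
  eq_PC_pos : 0 < PC;
  eq_KB_pos : 0 < KB;
  eq_KC_nonneg : 0 <= KC;
  eq_KB_supply : KB = supply_B pi phi theta PB PC;
  eq_KB_demand : KB = demand_B phi PB PC piB;
  eq_KC_supply : KC = supply_C pi phi theta PB PC;
  eq_KC_demand : KC = demand_C phi PB PC piB;
  eq_piB : piB = pi * PB / KB;
  eq_Q : Q = PB * KB
}.

Definition alpha_star (phi PB PC piB : R) : R :=
  (PB - PC) / (tilde_pi phi piB - tilde_pi_C phi).

Definition welfare_B (phi PB PC piB : R) : R :=
  RInt (fun a => tilde_pi phi piB * a - PB) (alpha_star phi PB PC piB) 1
  + RInt (fun a => phi * a - PC) (PC / phi) (alpha_star phi PB PC piB).

(* Buyers without access to B still face the price [PC] in C. *)
Definition welfare_0 (phi PC : R) : R :=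
  RInt (fun a => phi * a - PC) (PC / phi) 1.

Definition fundamental_price (phi PB PC piB : R) : R :=
  welfare_B phi PB PC piB - welfare_0 phi PC.

(* Main.v *)
Require Import Defs.
From Stdlib Require Import Reals Lra.
From Coquelicot Require Import Coquelicot.
Open Scope R_scope.

(** Access to B only changes the payoff of the buyers [a > alpha_star], so
    [v_B - v_0] is the integral over [[alpha_star, 1]] of the affine function
    [D a - (PB - PC)], where [D = (1 - phi) piB].  It vanishes at [alpha_star],
    hence the integral is [D (1 - alpha_star)^2 / 2].  Market clearing in B gives
    [1 - alpha_star = KB], and [piB KB = pi PB]. *)

Lemma RInt_affine (c p x y : R) :
  RInt (fun a => c * a - p) x y = c * (y ^ 2 - x ^ 2) / 2 - p * (y - x).
Proof.
apply is_RInt_unique.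
replace (c * (y ^ 2 - x ^ 2) / 2 - p * (y - x))
  with (minus (c * y ^ 2 / 2 - p * y) (c * x ^ 2 / 2 - p * x))
  by (unfold minus, plus, opp; simpl; field).
apply (is_RInt_derive (fun a => c * a ^ 2 / 2 - p * a)).
- intros a _; auto_derive; [easy | field].
- intros a _; apply (ex_derive_continuous (fun a => c * a - p)).
  auto_derive; easy.
Qed.

Lemma fundamental_price_eq (phi PB PC piB : R) :
  (1 - phi) * piB <> 0 ->
  fundamental_price phi PB PC piB
    = (1 - phi) * piB / 2 * (demand_B phi PB PC piB) ^ 2.
Proof.
intros hD.
assert (hgap : tilde_pi phi piB - phi = (1 - phi) * piB)
  by (unfold tilde_pi; ring).
unfold fundamental_price, welfare_B, welfare_0, demand_B, alpha_star, tilde_pi_C.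
rewrite !RInt_affine, hgap.
(* The slope in B is that in C plus the gap [D]; the [phi] part cancels against [welfare_0]. *)
replace (tilde_pi phi piB) with ((1 - phi) * piB + phi) by lra.
set (D := (1 - phi) * piB) in *.
(* The lower limit [PC / phi] is common to both C integrals and cancels; kept opaque, it leaves
   [D <> 0] as the only side condition of [field]. *)
set (x := PC / phi).
field; exact hD.
Qed.

Theorem proposition6 (pi phi theta : R)
    (hpi : 0 < pi < 1) (hphi : 0 < phi < 1) (htheta : 0 < theta <= 1)
    (Q PB PC piB KB KC : R)
    (heq : is_equilibrium pi phi theta Q PB PC piB KB KC) :
  fundamental_price phi PB PC piB = pi * (1 - phi) / 2 * (KB * PB) /\
  pi * (1 - phi) / 2 * (KB * PB) = pi * (1 - phi) / 2 * Q.
Proof.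
destruct heq as [hPB _ hKB _ _ hdemand _ _ hpiB hQ].
split; [| rewrite hQ; ring].
assert (hpiB_pos : 0 < piB).
{ rewrite hpiB; apply Rdiv_lt_0_compat; [apply Rmult_lt_0_compat |]; lra. }
(* [demand_B] mentions [piB], so it is folded into [KB] before [piB] is expanded; one factor of
   [KB ^ 2] then cancels. *)
rewrite fundamental_price_eq, <- hdemand, hpiB.
- field; lra.
- apply Rmult_integral_contrapositive_currified; lra.
Qed.
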